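(* Let the problem data, $\Sigma_0$, the multiplier cone $\mathcal M$, multipliers $M_0,\dots,M_N\in\mathcal M$, symmetric positive definite matrices $P_0,\dots,P_N\in\mathbb R^{(1+n)\times(1+n)}$, gains $K_0,\dots,K_N\in\mathbb R^{m\times(1+n)}$ and $\nu>0$ be as in the context. For notational convenience set $P_{N+1}:=P_N$. Define $$\widetilde P_k:=P_k^{-1},\quad\widetilde K_k:=K_kP_k^{-1},\quad\tilde\nu:=\nu^{-1},\quad Z:=\nu^{-2}\sqrt{\Sigma_0}\,P_0\sqrt{\Sigma_0},\quad\widetilde M_k:=M_k^{-1}=\begin{pmatrix}\widetilde M_k^{11}&\widetilde M_k^{12}\\ \widetilde M_k^{21}&\widetilde M_k^{22}\end{pmatrix}$$ ($Z$ playing the role of a slack variable), partition $\widetilde P_k=\begin{pmatrix}\tilde p_k^{11}&\tilde p_k^{12}\\ \tilde p_k^{21}&\widetilde P_k^{22}\end{pmatrix}$, $\widetilde K_k=\begin{pmatrix}\tilde k_k^1&\widetilde K_k^2\end{pmatrix}$, and for $k=0,\dots,N$ let $$\widetilde Q_k:=T_k\begin{pmatrix}\widetilde M_k^{22}&0&0&\widetilde M_k^{21}\\ 0&\widetilde P_{k+1}&0&0\\ 0&0&I&0\\ \widetilde M_k^{12}&0&0&\widetilde M_k^{11}\end{pmatrix}T_k^\top,\qquad T_k:=\begin{pmatrix}0&1&0&0&0\\ B_k^2&0&I&0&0\\ D_k^{12}&0&0&I&0\\ D_k^{32}&0&0&0&I\end{pmatrix}$$ (the second and third block columns of $T_k$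 together correspond to $\widetilde P_{k+1}$; thus $\widetilde P_N$ appears in both $\widetilde Q_{N-1}$ and $\widetilde Q_N$), and $$\begin{pmatrix}\tilde f_k^K&\widetilde A_k^K\\ \tilde g_k^{1K}&\widetilde C_k^{1K}\\ \tilde g_{ki}^{2K}&\widetilde C_{ki}^{2K}\\ \tilde g_k^{3K}&\widetilde C_k^{3K}\end{pmatrix}:=\begin{pmatrix}f_k&A_k&B_k^1\\ g_k^1&C_k^1&D_k^{11}\\ g_{ki}^2&C_{ki}^2&D_{ki}^{21}\\ g_k^3&C_k^3&D_k^{31}\end{pmatrix}\begin{pmatrix}\tilde p_k^{11}&\tilde p_k^{12}\\ \tilde p_k^{21}&\widetilde P_k^{22}\\ \tilde k_k^1&\widetilde K_k^2\end{pmatrix},\qquad\widetilde Y_k:=\begin{pmatrix}\tilde p_k^{11}&\tilde p_k^{12}\\ \tilde f_k^K&\widetilde A_k^K\\ \tilde g_k^{1K}&\widetilde C_k^{1K}\\ \tilde g_k^{3K}&\widetilde C_k^{3K}\end{pmatrix}.$$ With $$\mathcal N_k=\begin{pmatrix}-P_k&0&0&0&0\\ 0&M_k^{22}&0&0&M_k^{21}\\ 0&0&P_{k+1}&0&0\\ 0&0&0&I&0\\ 0&M_k^{12}&0&0&M_k^{11}\end{pmatrix},\quad E_k=\begin{pmatrix}1&0&0\\ 0&I&0\\ 0&0&I\\ 1&0&0\\ f_k^K&A_k^K&B_k^2\\ g_k^{1K}&C_k^{1K}&D_k^{12}\\ g_k^{3K}&C_k^{3K}&D_k^{32}\end{pmatrix},$$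 the matrix inequalities (R1) $E_k^\top\mathcal N_kE_k\preceq0$ for $k=0,\dots,N-1$; (P2) $\nu\ge\mathrm{trace}(P_0\Sigma_0)$; (R3) $E_N^\top\mathcal N_NE_N\preceq0$ (where both $-P_N$ and $P_N$ appear in $\mathcal N_N$); (P4) $P_k\succeq\nu\begin{pmatrix}g_{ki}^{2K}&C_{ki}^{2K}\end{pmatrix}^\top\begin{pmatrix}g_{ki}^{2K}&C_{ki}^{2K}\end{pmatrix}$ for $k=0,\dots,N$, $i=1,\dots,s$; are equivalent to the linear matrix inequalities (LR1) $\begin{pmatrix}\widetilde Q_k&\widetilde Y_k\\ \widetilde Y_k^\top&\widetilde P_k\end{pmatrix}\succeq0$ for $k=0,\dots,N-1$; (L2) $\begin{pmatrix}\widetilde P_0&\tilde\nu\sqrt{\Sigma_0}\\ \tilde\nu\sqrt{\Sigma_0}^\top&Z\end{pmatrix}\succeq0$ and $\mathrm{trace}\,Z\le\tilde\nu$; (L4) $\begin{pmatrix}\tilde p_k^{11}&\tilde p_k^{12}&(\tilde g_{ki}^{2K})^\top\\ \tilde p_k^{21}&\widetilde P_k^{22}&(\widetilde C_{ki}^{2K})^\top\\ \tilde g_{ki}^{2K}&\widetilde C_{ki}^{2K}&\tilde\nu I\end{pmatrix}\succeq0$ for $k=0,\dots,N$, $i=1,\dots,s$; (LR3) $\begin{pmatrix}\widetilde Q_N&\widetilde Y_N\\ \widetilde Y_N^\top&\widetilde P_N\end{pmatrix}\succeq0$.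
   Context: Fix $N\in\mathbb N_0$ and $n,m,l,r,s\in\mathbb N$. The data are real matrices/vectors of compatible sizes describing, for $k\in\mathbb N_0$ and $i=1,\dots,s$, the uncertain system with state $x_k\in\mathbb R^n$, input $u_k\in\mathbb R^m$, disturbance $w_k\in\mathbb R^l$: $x_{k+1}=f_k+A_kx_k+B_k^1u_k+B_k^2w_k$, $y_k=g_k^1+C_k^1x_k+D_k^{11}u_k+D_k^{12}w_k$, $v_{ki}=g_{ki}^2+C_{ki}^2x_k+D_{ki}^{21}u_k$, $z_k=g_k^3+C_k^3x_k+D_k^{31}u_k+D_k^{32}w_k\in\mathbb R^r$; all these data are constant in $k$ for $k\ge N$. $\bar x\in\mathbb R^n$ is the initial state, $\Sigma_0:=\begin{pmatrix}1\\ \bar x\end{pmatrix}\begin{pmatrix}1\\ \bar x\end{pmatrix}^\top$ with positive semidefinite square root $\sqrt{\Sigma_0}$. $\mathcal M$ is a convex cone of symmetric matrices $M=\begin{pmatrix}M^{11}&M^{12}\\ M^{21}&M^{22}\end{pmatrix}\in\mathbb R^{(r+l)\times(r+l)}$, $M^{11}\in\mathbb R^{r\times r}$, $M^{22}\in\mathbb R^{l\times l}$, such that every $M\in\mathcal M$ is invertible with $M^{11}\succ0$ and $M^{22}\prec0$, and such that the inverses of its elements lie in another convex cone $\mathcal M'$. Inverses $\widetilde M$ are partitioned in the same way as $M$. Gains are partitioned as $K_k=\begin{pmatrix}k_k^1&K_k^2\end{pmatrix}$ with $k_k^1\in\mathbb R^m$, $K_k^2\in\mathbb R^{m\times n}$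 (policy $u_k=k_k^1+K_k^2x_k$), and $$\begin{pmatrix}f_k^K&A_k^K\\ g_k^{1K}&C_k^{1K}\\ g_{ki}^{2K}&C_{ki}^{2K}\\ g_k^{3K}&C_k^{3K}\end{pmatrix}:=\begin{pmatrix}f_k&A_k&B_k^1\\ g_k^1&C_k^1&D_k^{11}\\ g_{ki}^2&C_{ki}^2&D_{ki}^{21}\\ g_k^3&C_k^3&D_k^{31}\end{pmatrix}\begin{pmatrix}1&0\\ 0&I\\ k_k^1&K_k^2\end{pmatrix}.$$ Matrices $\widetilde P_k$ are partitioned with $\tilde p_k^{11}\in\mathbb R$, $\widetilde P_k^{22}\in\mathbb R^{n\times n}$. $\succeq,\preceq$ denote the Loewner order.
   Formalization: In T_k the last diagonal entry (row of D_k^{32}, column of \widetilde M_k^{11}) is taken as -I instead of I; with +I the equivalence fails, e.g. N=0, scalar data all zero except D^{32}=1, x̄=0, M=(1 1/2; 1/2 -1), P_0=I, K_0=0, ν=1. *)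

(* Defs.v *)
From HB Require Import structures.
From mathcomp Require Import all_boot all_order all_algebra.
From mathcomp Require Import classical_sets reals.

Set Implicit Arguments.
Unset Strict Implicit.
Unset Printing Implicit Defensive.

Import Order.TTheory GRing.Theory Num.Theory.

Local Open Scope ring_scope.

Section Definiteness.
Variables (R : realType) (d : nat).
Implicit Types A B : 'M[R]_d.

Definition psdmx A : Prop :=
  A^T = A /\ forall x : 'cV[R]_d, 0 <= (x^T *m A *m x) 0 0.

Definition pdmx A : Prop :=
  A^T = A /\ forall x : 'cV[R]_d, x != 0 -> 0 < (x^T *m A *m x) 0 0.

Definition loewner_le A B : Prop := psdmx (B - A).
Definition loewner_lt A B : Prop := pdmx (B - A).

(* The positive semidefinite square root of A is the unique such S. *)
Definition is_psd_sqrt A S : Prop := psdmx S /\ S *m S = A.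

End Definiteness.

Notation "A ⪯ B" := (loewner_le A B) (at level 70, no associativity).
Notation "A ⪰ B" := (loewner_le B A) (at level 70, only parsing).
Notation "A ≺ B" := (loewner_lt A B) (at level 70, no associativity).
Notation "A ≻ B" := (loewner_lt B A) (at level 70, only parsing).

(* A cone is closed under multiplication by positive scalars; it need not
   contain 0 (a cone of invertible matrices cannot). *)
Definition convex_cone (R : realType) (V : lmodType R) (C : set V) : Prop :=
  (forall (a : R) (x : V), 0 < a -> C x -> C (a *: x)) /\
  (forall (a : R) (x y : V), 0 <= a <= 1 -> C x -> C y ->
     C (a *: x + (1 - a) *: y)).

Section Multipliers.
Variables (R : realType) (r l : nat).

(* For M : 'M_(r + l), M^11, M^12, M^21, M^22 are ulsubmx M, ursubmx M,
   dlsubmx M and drsubmx M. *)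
Definition multiplier_cone (C C' : set 'M[R]_(r + l)) : Prop :=
  [/\ convex_cone C, convex_cone C' &
    forall M, C M ->
      [/\ M^T = M, M \in unitmx, ulsubmx M ≻ 0, drsubmx M ≺ 0 &
          C' (invmx M)]].

End Multipliers.

(* x_k in R^n, u_k in R^m, w_k in R^l, y_k in R^p, z_k in R^r and
   v_ki in R^(q i) for i : 'I_s. *)
Record uncertain_system (R : realType) (n m l p r s : nat) (q : 'I_s -> nat) :=
  UncertainSystem {
    f   : nat -> 'cV[R]_n;
    A   : nat -> 'M[R]_(n, n);
    B1  : nat -> 'M[R]_(n, m);
    B2  : nat -> 'M[R]_(n, l);
    g1  : nat -> 'cV[R]_p;
    C1  : nat -> 'M[R]_(p, n);
    D11 : nat -> 'M[R]_(p, m);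
    D12 : nat -> 'M[R]_(p, l);
    g2  : nat -> forall i : 'I_s, 'cV[R]_(q i);
    C2  : nat -> forall i : 'I_s, 'M[R]_(q i, n);
    D21 : nat -> forall i : 'I_s, 'M[R]_(q i, m);
    g3  : nat -> 'cV[R]_r;
    C3  : nat -> 'M[R]_(r, n);
    D31 : nat -> 'M[R]_(r, m);
    D32 : nat -> 'M[R]_(r, l) }.

Definition constant_from (R : realType) (n m l p r s : nat) (q : 'I_s -> nat)
    (S : uncertain_system R n m l p r q) (N : nat) : Prop :=
  forall k, (N <= k)%N ->
    [/\ [/\ f S k = f S N, A S k = A S N, B1 S k = B1 S N & B2 S k = B2 S N],
        [/\ g1 S k = g1 S N, C1 S k = C1 S N, D11 S k = D11 S N
          & D12 S k = D12 S N],
        (forall i, [/\ g2 S k i = g2 S N i, C2 S k i = C2 S N i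
          & D21 S k i = D21 S N i]) &
        [/\ g3 S k = g3 S N, C3 S k = C3 S N, D31 S k = D31 S N
          & D32 S k = D32 S N]].

Definition Sigma0 (R : realType) (n : nat) (xbar : 'cV[R]_n) : 'M[R]_(1 + n) :=
  col_mx 1%:M xbar *m (col_mx 1%:M xbar)^T.

Section Matrices.
Variables (R : realType) (n m l p r s : nat) (q : 'I_s -> nat).
Variable S : uncertain_system R n m l p r q.
Implicit Types (k : nat) (i : 'I_s) (M : 'M[R]_(r + l)) (P X : 'M[R]_(1 + n))
  (K : 'M[R]_(m, 1 + n)).

(* The block rows of
     (f A B^1; g^1 C^1 D^11; g^2 C^2 D^21; g^3 C^3 D^31) *m (X; K).
   X = I gives (f^K A^K), (g^1K C^1K), ...; X = P^-1 with K replaced by K P^-1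
   gives the corresponding quantities with tildes. *)
Definition fA k X K : 'M[R]_(n, 1 + n) :=
  row_mx (row_mx (f S k) (A S k)) (B1 S k) *m col_mx X K.
Definition gC1 k X K : 'M[R]_(p, 1 + n) :=
  row_mx (row_mx (g1 S k) (C1 S k)) (D11 S k) *m col_mx X K.
Definition gC2 k i X K : 'M[R]_(q i, 1 + n) :=
  row_mx (row_mx (g2 S k i) (C2 S k i)) (D21 S k i) *m col_mx X K.
Definition gC3 k X K : 'M[R]_(r, 1 + n) :=
  row_mx (row_mx (g3 S k) (C3 S k)) (D31 S k) *m col_mx X K.

(* ( M^22 0 0 M^21 ; 0 P 0 0 ; 0 0 I 0 ; M^12 0 0 M^11 ) *)
Definition middle M P : 'M[R]_(l + ((1 + n) + (p + r))) :=
  block_mx (drsubmx M)                        (row_mx 0 (row_mx 0 (dlsubmx M)))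
           (col_mx 0 (col_mx 0 (ursubmx M)))  (block_mx P 0
                                                0 (block_mx 1%:M 0
                                                     0 (ulsubmx M))).

Definition Nmx M P Pnext : 'M[R]_((1 + n) + (l + ((1 + n) + (p + r)))) :=
  block_mx (- P) 0
           0     (middle M Pnext).

Definition Emx k K : 'M[R]_((1 + n) + (l + ((1 + n) + (p + r))), (1 + n) + l) :=
  col_mx (row_mx 1%:M 0)
 (col_mx (row_mx 0 1%:M)
 (col_mx (col_mx (row_mx (row_mx 1%:M 0) 0)
                 (row_mx (fA k 1%:M K) (B2 S k)))
 (col_mx (row_mx (gC1 k 1%:M K) (D12 S k))
         (row_mx (gC3 k 1%:M K) (D32 S k))))).

(* With Emx = (I; G), the inequality Emx^T N Emx <= 0 dualizes to
   (G, -I) N^-1 (G, -I)^T >= 0, because the columns of (G, -I)^T span the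
   orthogonal complement of those of Emx.  The sign of -I matters only in the
   row of z, where the multiplier couples it to the columns of B^2, D^12, D^32;
   hence the - 1%:M below.  With + 1%:M the mixed terms of M^-1 would have the
   wrong sign and the dual inequality would not be equivalent to the primal
   one. *)
Definition Tmx k : 'M[R]_(1 + (n + (p + r)), l + ((1 + n) + (p + r))) :=
  col_mx (row_mx 0         (row_mx (row_mx 1%:M 0) (row_mx 0    0)))
 (col_mx (row_mx (B2 S k)  (row_mx (row_mx 0 1%:M) (row_mx 0    0)))
 (col_mx (row_mx (D12 S k) (row_mx (row_mx 0 0)    (row_mx 1%:M 0)))
         (row_mx (D32 S k) (row_mx (row_mx 0 0)    (row_mx 0    (- 1%:M)))))).

Definition Qmx k M P : 'M[R]_(1 + (n + (p + r))) :=
  Tmx k *m middle M P *m (Tmx k)^T.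

Definition Ymx k P K : 'M[R]_(1 + (n + (p + r)), 1 + n) :=
  col_mx (usubmx P) (col_mx (fA k P K) (col_mx (gC1 k P K) (gC3 k P K))).

End Matrices.

(* Main.v *)
(* (R1) and (R3) say that the quadratic form N_k is nonpositive on im E_k, the
   graph of a linear map from the coordinates (x, w), where N_k is nonpositive,
   to the remaining coordinates, where N_k is nonnegative.  Splitting
   any vector into a component in im E_k and one in the coordinate subspace that
   complements it shows that the inverse form is then nonnegative on the
   orthogonal complement of im E_k; the converse is the same statement applied
   to the negated inverse form.  The dual inequality reads
   Q~_k - L P~_k L^T >= 0 with Y~_k = L P~_k, so that (LR1) and (LR3) follow by a
   Schur complement.  (P4) and (L4) are also related by a Schur complement and
   the congruence with P_k, and in (L2) the Schur complement of P~_0 vanishes by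
   the choice of Z, leaving only the trace inequality. *)
Require Import Defs.
From HB Require Import structures.
From mathcomp Require Import all_boot all_order all_algebra.
From mathcomp Require Import classical_sets reals.

Set Implicit Arguments.
Unset Strict Implicit.
Unset Printing Implicit Defensive.

Import Order.TTheory GRing.Theory Num.Theory.

Local Open Scope ring_scope.

(** * Positive semidefinite matrices and Schur complements *)

Lemma psdmx_congr (R : realType) a b (A : 'M[R]_a) (X : 'M[R]_(a, b)) :
  psdmx A -> psdmx (X^T *m A *m X).
Proof.
move=> [sA pA]; split; first by rewrite !trmx_mul trmxK sA mulmxA.
by move=> x; have := pA (X *m x); rewrite trmx_mul !mulmxA.
Qed.

Lemma psdmxD (R : realType) a (A B : 'M[R]_a) :
  psdmx A -> psdmx B -> psdmx (A + B).
Proof.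
move=> [sA pA] [sB pB]; split; first by rewrite raddfD /= sA sB.
by move=> x; rewrite mulmxDr mulmxDl mxE addr_ge0.
Qed.

Lemma psdmx1 (R : realType) a : psdmx (1%:M : 'M[R]_a).
Proof.
split=> [|x]; first exact: trmx1.
by rewrite mulmx1 mxE sumr_ge0 // => i _; rewrite mxE -expr2 sqr_ge0.
Qed.

Lemma psdmxZ (R : realType) a (c : R) (A : 'M[R]_a) :
  0 <= c -> psdmx A -> psdmx (c *: A).
Proof.
move=> c0 [sA pA]; split=> [|x]; first by rewrite linearZ /= sA.
by rewrite -scalemxAr -scalemxAl mxE mulr_ge0.
Qed.

Lemma psdmx_block_diag (R : realType) a b (A : 'M[R]_a) (B : 'M[R]_b) :
  psdmx A -> psdmx B -> psdmx (block_mx A 0 0 B).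
Proof.
move=> [sA pA] [sB pB]; split; first by rewrite tr_block_mx sA sB !trmx0.
move=> x; rewrite -[x]vsubmxK tr_col_mx mul_row_block !mulmx0 addr0 add0r.
by rewrite mul_row_col mxE addr_ge0.
Qed.

Lemma pdmx_psdmx (R : realType) a (A : 'M[R]_a) : pdmx A -> psdmx A.
Proof.
move=> [sA pA]; split=> // x; have [->|/pA/ltW//] := eqVneq x 0.
by rewrite mulmx0 mxE.
Qed.

Lemma pdmx_unit (R : realType) a (A : 'M[R]_a) : pdmx A -> A \in unitmx.
Proof.
move=> [_ pA]; rewrite -row_free_unit -kermx_eq0; apply/rowV0P => v /sub_kermxP vA.
apply/eqP; apply: contraT => v0; have := pA v^T.
by rewrite trmx_eq0 trmxK vA mul0mx mxE ltxx => /(_ v0).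
Qed.

Lemma psdmx_invmx (R : realType) a (A : 'M[R]_a) :
  A \in unitmx -> psdmx A -> psdmx (invmx A).
Proof.
move=> uA pA; have := @psdmx_congr _ _ _ _ (invmx A) pA.
by rewrite trmx_inv (proj1 pA) mulVmx // mul1mx.
Qed.

(** Writing the off-diagonal block as [X *m D] gives a Schur complement free of inverses. Forward,
    the form is restricted to vectors (x, -X^T x); backward, diag(A - X D X^T, D) undergoes a
    congruence with a unit triangular matrix. *)
Lemma psdmx_schur (R : realType) a b (A : 'M[R]_a) (D : 'M[R]_b)
    (X : 'M[R]_(a, b)) :
  psdmx D ->
  psdmx (block_mx A (X *m D) (X *m D)^T D) <-> psdmx (A - X *m D *m X^T).
Proof.
move=> pD; have sD := proj1 pD; split=> [pB|pA].
  have := @psdmx_congr _ _ _ _ (col_mx 1%:M (- X^T)) pB.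
  rewrite tr_col_mx mul_row_block mul_row_col trmx1 linearN /= trmxK trmx_mul sD.
  by rewrite !mul1mx mulmx1 !mulNmx subrr mul0mx addr0 mulmxA.
have := @psdmx_congr _ _ _ _ (block_mx 1%:M 0 X^T 1%:M) (psdmx_block_diag pA pD).
rewrite tr_block_mx !mulmx_block !trmx1 trmxK trmx0 !mulmx0 !mul0mx !mul1mx !mulmx1.
by rewrite !addr0 !add0r subrK trmx_mul sD.
Qed.

Lemma psdmx_schur_ul (R : realType) a b (A : 'M[R]_a) (D : 'M[R]_b)
    (X : 'M[R]_(b, a)) :
  psdmx A ->
  psdmx (D - X *m A *m X^T) -> psdmx (block_mx A (X *m A)^T (X *m A) D).
Proof.
move=> pA pD; have sA := proj1 pA.
have := @psdmx_congr _ _ _ _ (block_mx 1%:M X^T 0 1%:M) (psdmx_block_diag pA pD).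
rewrite tr_block_mx !mulmx_block !trmx1 trmxK trmx0 !mulmx0 !mul0mx !mul1mx !mulmx1.
by rewrite !addr0 !add0r addrC subrK trmx_mul sA.
Qed.

(** * Duality of quadratic forms *)

(* If the columns of E and V span the space, F^T E = 0 and V^T N V >= 0, then
   splitting N^-1 F = U + W with U in im E and W in im V makes U orthogonal to
   N^-1 F for the form N, so F^T N^-1 F = W^T N W - U^T N U. *)
Lemma dual_psdmx (R : realType) d a b c (N Ni : 'M[R]_d) (E : 'M[R]_(d, a))
    (F : 'M[R]_(d, b)) (V : 'M[R]_(d, c)) (X : 'M[R]_(a, d))
    (Y : 'M[R]_(c, d)) :
  N^T = N -> Ni^T = Ni -> N *m Ni = 1%:M -> F^T *m E = 0 ->
  E *m X + V *m Y = 1%:M ->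
  psdmx (V^T *m N *m V) -> psdmx (- (E^T *m N *m E)) ->
  psdmx (F^T *m Ni *m F).
Proof.
move=> sN sNi NNi FE EV pV pE.
have NiN : Ni *m N = 1%:M by apply: mulmx1C.
pose U := E *m X *m Ni *m F; pose W := V *m Y *m Ni *m F.
have UW : U + W = Ni *m F by rewrite /U /W -!mulmxDl EV mul1mx.
have UN : U^T *m N *m (U + W) = 0.
  rewrite UW -[_ *m N *m _]mulmxA (mulmxA N) NNi mul1mx.
  by apply: trmx_inj; rewrite trmx_mul trmxK /U !mulmxA FE !mul0mx trmx0.
have NU : (U + W)^T *m N *m U = 0.
  by apply: trmx_inj; rewrite trmx_mul (trmx_mul _ N) trmxK sN mulmxA UN trmx0.
have -> : F^T *m Ni *m F = W^T *m N *m W - U^T *m N *m U.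
  have -> : F^T *m Ni *m F = (U + W)^T *m N *m (U + W).
    by rewrite UW trmx_mul sNi -!mulmxA (mulmxA N) NNi mul1mx.
  (* With W = (U + W) - U, the cross terms of W^T N W vanish by [UN] and [NU]. *)
  have {3 4}-> : W = (U + W) - U by rewrite addrC addKr.
  rewrite [((U + W) - U)^T]raddfB /= !mulmxBl !mulmxBr NU UN.
  by rewrite subr0 sub0r opprK addrK.
have -> : - (U^T *m N *m U) =
    (X *m Ni *m F)^T *m (- (E^T *m N *m E)) *m (X *m Ni *m F).
  by rewrite mulmxN mulNmx /U -!mulmxA !(trmx_mul E) !mulmxA.
have -> : W^T *m N *m W =
    (Y *m Ni *m F)^T *m (V^T *m N *m V) *m (Y *m Ni *m F).
  by rewrite /W -!mulmxA !(trmx_mul V) !mulmxA.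
by apply: psdmxD; apply: psdmx_congr.
Qed.

(** Each direction is an instance of [dual_psdmx]. The sign conditions on the corners of [D] and
    [Di] control the forms on the coordinate subspaces that complement im E and im F,
    respectively. *)
Lemma dual_graph (R : realType) a l b (P : 'M[R]_a) (D Di : 'M[R]_(l + b))
    (L : 'M[R]_(b, a)) (J : 'M[R]_(b, l)) :
  let E := col_mx (row_mx 1%:M 0) (col_mx (row_mx 0 1%:M) (row_mx L J)) in
  pdmx P -> D^T = D -> D *m Di = 1%:M ->
  psdmx (drsubmx D) -> psdmx (- ulsubmx Di) ->
  psdmx (- (E^T *m block_mx (- P) 0 0 D *m E)) <->
  psdmx (row_mx J (- 1%:M) *m Di *m (row_mx J (- 1%:M))^T
         - L *m invmx P *m L^T).
Proof.
move=> E pdP sD DDi pD pDi.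
have pP := pdmx_psdmx pdP; have uP := pdmx_unit pdP.
have sP := proj1 pP.
have pPi := psdmx_invmx uP pP; have sPi := proj1 pPi.
have DiD : Di *m D = 1%:M by apply: mulmx1C.
have sDi : Di^T = Di.
  by rewrite -[LHS]mulmx1 -DDi mulmxA -{1}sD -trmx_mul DDi trmx1 mul1mx.
pose N := block_mx (- P) 0 0 D; pose Ni := block_mx (- invmx P) 0 0 Di.
have sN : N^T = N by rewrite tr_block_mx linearN /= sP !trmx0 sD.
have sNi : Ni^T = Ni by rewrite tr_block_mx linearN /= sPi !trmx0 sDi.
have NNi : N *m Ni = 1%:M.
  rewrite mulmx_block !mulmx0 !mul0mx !addr0 add0r mulNmx mulmxN opprK mulmxV //.
  by rewrite DDi -scalar_mx_block.
pose F := col_mx L^T (row_mx J (- 1%:M))^T.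
have FE : F^T *m E = 0.
  rewrite tr_col_mx !trmxK /E !mul_row_col !mul_mx_row !mulmx1 !mulmx0 !mulNmx !mul1mx.
  by rewrite !add_row_mx !add0r !subrr row_mx0.
have -> : row_mx J (- 1%:M) *m Di *m (row_mx J (- 1%:M))^T - L *m invmx P *m L^T
    = F^T *m Ni *m F.
  rewrite tr_col_mx !trmxK mul_row_block !mulmx0 addr0 add0r mul_row_col.
  by rewrite mulmxN mulNmx addrC.
(* Splitting along the graph: (x, w, v) = E (x, w) + (0, 0, v - L x - J w). *)
pose V : 'M[R]_(a + (l + b), b) := col_mx 0 (col_mx 0 1%:M).
pose X : 'M[R]_(a + l, a + (l + b)) :=
  col_mx (row_mx 1%:M 0) (row_mx 0 (row_mx 1%:M 0)).
pose Y : 'M[R]_(b, a + (l + b)) := row_mx (- L) (row_mx (- J) 1%:M).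
have EV : E *m X + V *m Y = 1%:M.
  rewrite /E /X /V /Y !mul_col_mx !mul_row_col !mul0mx !mul1mx !addr0 !add0r.
  rewrite !mul_mx_row !mulmx1 !mulmx0 !add_col_mx !add_row_mx.
  rewrite !addr0 !add0r !subrr scalar_mx_block /block_mx; congr col_mx.
  rewrite add_row_mx subrr add0r -block_mxEv block_mxEh col_mx0 -block_mxEv.
  by rewrite -scalar_mx_block.
(* The dual splitting: (x, w, v) = F (-v) + (x + L^T v, w + J^T v, 0). *)
pose W : 'M[R]_(a + (l + b), a + l) :=
  col_mx (row_mx 1%:M 0) (col_mx (row_mx 0 1%:M) 0).
pose X' : 'M[R]_(b, a + (l + b)) := row_mx 0 (row_mx 0 (- 1%:M)).
pose Y' : 'M[R]_(a + l, a + (l + b)) :=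
  col_mx (row_mx 1%:M (row_mx 0 L^T)) (row_mx 0 (row_mx 1%:M J^T)).
have FW : F *m X' + W *m Y' = 1%:M.
  rewrite /F tr_row_mx /X' /W /Y' linearN /= trmx1.
  rewrite !mul_col_mx !mul_row_col !mul0mx !mul1mx !addr0 !add0r.
  rewrite !mul_mx_row !mulmx0 !mulmxN !mulmx1 ?mulNmx ?mul1mx ?opprK.
  rewrite !add_col_mx !add_row_mx.
  rewrite !addr0 !add0r !addNr scalar_mx_block /block_mx row_mx0; congr col_mx.
  by rewrite -block_mxEv block_mxEh col_mx0 -block_mxEv -scalar_mx_block.
have pV : psdmx (V^T *m N *m V).
  rewrite /V !tr_col_mx trmx1 !trmx0 mul_row_block !mul0mx !mulmx0 !add0r.
  rewrite -{1}[D]submxK mul_row_block !mul0mx !mul1mx !add0r !mul_row_col.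
  by rewrite !mulmx0 !add0r mulmx1.
have pW : psdmx (W^T *m (- Ni) *m W).
  have -> : W = block_mx 1%:M 0 0 (col_mx 1%:M 0).
    rewrite /block_mx /W; congr col_mx.
    by rewrite -[X in col_mx _ X = _]row_mx0 -block_mxEv block_mxEh col_mx0.
  rewrite /Ni opp_block_mx opprK tr_block_mx !mulmx_block tr_col_mx !trmx1 !trmx0.
  rewrite !oppr0 !mulmx0 !mul0mx !mulmx1 !mul1mx !addr0 !add0r.
  rewrite -{1}[Di]submxK opp_block_mx mul_row_block !mul0mx !mul1mx !addr0.
  rewrite mul_row_col mulmx1 mulmx0 addr0.
  exact: psdmx_block_diag.
split=> [pE|pF]; first exact: (dual_psdmx sN sNi NNi FE EV).
(* For the converse, -N^-1 takes the place of N, E and F exchange roles, and W replaces V. *)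
have sNN : (- N)^T = - N by rewrite linearN /= sN.
have sNNi : (- Ni)^T = - Ni by rewrite linearN /= sNi.
have NiN : - Ni *m - N = 1%:M by rewrite mulNmx mulmxN opprK; apply: mulmx1C.
have EF : E^T *m F = 0 by apply: trmx_inj; rewrite trmx_mul trmxK FE trmx0.
have := dual_psdmx sNNi sNN NiN EF FW pW.
by rewrite !mulmxN !mulNmx opprK; apply.
Qed.

(** This is [dual_psdmx] for -M with complementary coordinate subspaces im E and im F, so F also
    serves as V. It supplies the sign that [dual_graph] asks of the corner of [Di]. *)
Lemma invmx_dr_npsd (R : realType) a b (M : 'M[R]_(a + b)) :
  M^T = M -> M \in unitmx -> psdmx (ulsubmx M) -> psdmx (- drsubmx M) ->
  psdmx (- drsubmx (invmx M)).
Proof.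
move=> sM uM pul pdr.
pose E : 'M[R]_(a + b, a) := col_mx 1%:M 0.
pose F : 'M[R]_(a + b, b) := col_mx 0 1%:M.
have drE A : F^T *m A *m F = drsubmx A.
  rewrite -{1}[A]submxK tr_col_mx mul_row_block mul_row_col trmx0 trmx1.
  by rewrite !mul0mx !mul1mx mulmx0 mulmx1 !add0r.
have ulE A : E^T *m A *m E = ulsubmx A.
  rewrite -{1}[A]submxK tr_col_mx mul_row_block mul_row_col trmx0 trmx1.
  by rewrite !mul0mx !mul1mx mulmx0 mulmx1 !addr0.
rewrite -drE -mulNmx -mulmxN.
apply: (@dual_psdmx _ _ _ _ _ (- M) _ E F F (row_mx 1%:M 0) (row_mx 0 1%:M)).
- by rewrite linearN /= sM.
- by rewrite linearN /= trmx_inv sM.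
- by rewrite mulNmx mulmxN opprK mulmxV.
- by rewrite tr_col_mx mul_row_col trmx0 trmx1 mul0mx mulmx0 addr0.
- rewrite !mul_col_mx !mul0mx !mul1mx add_col_mx addr0 add0r.
  by rewrite -block_mxEv -scalar_mx_block.
- by rewrite mulmxN mulNmx drE.
- by rewrite mulmxN mulNmx ulE opprK.
Qed.

(** * The middle factor and the two blockings of the stacked rows *)

(** Up to a permutation of coordinates, [middle p M P] is diag(M, P, I), so inverse pairs are sent
    to inverse pairs. *)
Lemma mulmx_middle (R : realType) n p r l (M M' : 'M[R]_(r + l))
    (P P' : 'M[R]_(1 + n)) :
  M *m M' = 1%:M -> P *m P' = 1%:M -> middle p M P *m middle p M' P' = 1%:M.
Proof.
rewrite -{1}[M]submxK -{1}[M']submxK mulmx_block scalar_mx_block.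
move=> /eq_block_mx[e11 e12 e21 e22] PP'.
rewrite /middle mulmx_block [RHS]scalar_mx_block; congr block_mx.
- by rewrite !mul_row_col !mul0mx !add0r addrC.
- rewrite !mul_mx_row !mul_row_block !mul0mx !mulmx0 ?add0r ?addr0.
  by rewrite !add_row_mx !add0r addrC e21 !row_mx0.
- rewrite !mul_block_col !mul_col_mx !mul0mx !mulmx0 ?add0r ?addr0.
  by rewrite !add_col_mx !add0r addrC e12 !col_mx0.
- rewrite mul_col_mx mul0mx mul_col_mx mul0mx !mul_mx_row !mulmx0 !mulmx_block.
  rewrite !mul0mx !mulmx0 !mul1mx ?addr0 ?add0r PP'.
  set X := ursubmx M *m _.
  have -> : col_mx 0 (col_mx 0 (row_mx 0 (row_mx 0 X))) =
      block_mx 0 0 0 (block_mx 0 0 0 X) :> 'M_((1 + n) + (p + r)).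
    rewrite /block_mx row_mx0; congr col_mx.
    by rewrite row_mx0 -[Y in col_mx Y _ = _]row_mx0 -block_mxEv block_mxEh col_mx0.
  by rewrite !add_block_mx !addr0 !add0r addrC e11 -!scalar_mx_block.
Qed.

Lemma tr_middle (R : realType) n p r l (M : 'M[R]_(r + l)) (P : 'M[R]_(1 + n)) :
  M^T = M -> P^T = P -> (middle p M P)^T = middle p M P.
Proof.
move=> sM sP; rewrite /middle !tr_block_mx !tr_row_mx !tr_col_mx !trmx0 sP trmx1.
by rewrite !trmx_drsub !trmx_dlsub !trmx_ursub !trmx_ulsub sM.
Qed.

Section StackAssoc.
Variables (R : realType) (n c : nat).

(* The identity matrix, reading its columns as (1 + n) + c and its rows as
   1 + (n + c); [Tmx] is blocked by the latter and [Emx] by the former. *)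
Definition stack_assoc : 'M[R]_(1 + (n + c), (1 + n) + c) :=
  col_mx (row_mx (row_mx 1%:M 0) 0)
 (col_mx (row_mx (row_mx 0 1%:M) 0) (row_mx 0 1%:M)).

Lemma mul_stack_assoc a (X : 'M[R]_(1, a)) (Y : 'M[R]_(n, a)) (Z : 'M[R]_(c, a)) :
  stack_assoc *m col_mx (col_mx X Y) Z = col_mx X (col_mx Y Z).
Proof.
by rewrite !mul_col_mx !mul_row_col !mul0mx !mul1mx ?addr0 ?add0r.
Qed.

(** This makes congruence by [stack_assoc] reversible, so semidefiniteness transfers between the two
    blockings. *)
Lemma tr_mul_stack_assoc : stack_assoc^T *m stack_assoc = 1%:M.
Proof.
rewrite /stack_assoc !tr_col_mx !tr_row_mx !trmx0 !trmx1.
rewrite !mul_row_col !mul_col_row !mul0mx !mulmx0 !mul1mx.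
rewrite !add_block_mx !addr0 !add0r add_block_mx !addr0 !add0r.
by rewrite -!scalar_mx_block.
Qed.

End StackAssoc.

(** * Dualization of the Riccati inequality *)

Section Dualization.
Variables (R : realType) (n m l p r s : nat) (q : 'I_s -> nat).
Variable S : uncertain_system R n m l p r q.

(** [Lmx] and [Jmx] are the slopes, in (1, x) and in w, of the graph im [Emx]. *)
Let Lmx k K : 'M[R]_((1 + n) + (p + r), 1 + n) :=
  col_mx (col_mx (row_mx 1%:M 0) (fA S k 1%:M K))
         (col_mx (gC1 S k 1%:M K) (gC3 S k 1%:M K)).
Let Jmx k : 'M[R]_((1 + n) + (p + r), l) :=
  col_mx (col_mx 0 (B2 S k)) (col_mx (D12 S k) (D32 S k)).

Let EmxE k K : Emx S k K =
  col_mx (row_mx 1%:M 0) (col_mx (row_mx 0 1%:M) (row_mx (Lmx k K) (Jmx k))).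
Proof.
rewrite /Emx /Lmx /Jmx; congr col_mx; congr col_mx.
by rewrite -!block_mxEv !block_mxEh -block_mxEv block_mxEh.
Qed.

Let YmxE k P K :
  Ymx S k P (K *m P) = stack_assoc R n (p + r) *m Lmx k K *m P.
Proof.
rewrite mul_stack_assoc !mul_col_mx /fA /gC1 /gC3 -!mulmxA !mul_col_mx !mul1mx.
have -> // : row_mx 1%:M 0 *m P = usubmx P.
by rewrite -{1}[P]vsubmxK mul_row_col mul1mx mul0mx addr0.
Qed.

(** [dual_graph] produces -1 in every row, [Tmx] only in the row of z. The right factor flips the
    column blocks facing P and I; the first and last blocks, which the multiplier couples, keep
    equal signs. *)
Let TmxE k : Tmx S k = stack_assoc R n (p + r) *m row_mx (Jmx k) (- 1%:M) *m
  block_mx 1%:M 0 0 (block_mx (- 1%:M) 0 0 (block_mx (- 1%:M) 0 0 1%:M)).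
Proof.
rewrite -mulmxA mul_row_block !mulmx0 mulmx1 add0r addr0 mulNmx mul1mx.
rewrite !opp_block_mx !oppr0 opprK mul_mx_row.
rewrite mul_stack_assoc opprK.
have -> : block_mx 1%:M 0 0 (block_mx 1%:M 0 0 (- 1%:M)) =
    col_mx (col_mx (row_mx (row_mx 1%:M 0) 0) (row_mx (row_mx 0 1%:M) 0))
           (col_mx (row_mx 0 (row_mx 1%:M 0)) (row_mx 0 (row_mx 0 (- 1%:M))))
    :> 'M[R]_((1 + n) + (p + r)).
  rewrite [LHS]block_mxEv; congr col_mx.
    by rewrite -block_mxEv block_mxEh col_mx0 -block_mxEv -scalar_mx_block.
  by rewrite -block_mxEv [RHS]block_mxEh col_mx0 -block_mxEv.
rewrite mul_stack_assoc -[RHS]block_mxEh block_mxEv -block_mxEh block_mxEv.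
by rewrite -block_mxEh block_mxEv /Tmx !row_mx0.
Qed.

(* Conjugation by the signs diag(I, -I, -I, I) fixes the block structure of
   [middle], which reconciles the - 1%:M of [dual_graph] with [Tmx]. *)
Let QmxE k M P : Qmx S k M P =
  stack_assoc R n (p + r) *m (row_mx (Jmx k) (- 1%:M) *m middle p M P *m
    (row_mx (Jmx k) (- 1%:M))^T) *m (stack_assoc R n (p + r))^T.
Proof.
rewrite /Qmx TmxE; set G := block_mx 1%:M 0 0 _.
have GMG : G *m middle p M P *m G^T = middle p M P.
  rewrite /G /middle !tr_block_mx !linearN /= !trmx0 !trmx1 !mulmx_block.
  rewrite !(mulmx0, mul0mx, mul1mx, mulmx1) !(addr0, add0r).
  rewrite !(mulNmx, mulmxN, mul1mx, mulmx1, opprK, mulmx0, mul0mx).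
  rewrite mul_row_block mul_block_col mulmx_block mul_row_block mul_block_col.
  rewrite mulmx_block.
  by rewrite !(mulmx0, mul0mx, mulmxN, mul1mx, mulmx1, opprK, addr0, add0r).
by rewrite -[in RHS]GMG !trmx_mul !mulmxA.
Qed.

Lemma riccati_dualization k (K : 'M_(m, 1 + n)) (M : 'M_(r + l))
    (P Pnext : 'M_(1 + n)) :
  M^T = M -> M \in unitmx -> ulsubmx M ≻ 0 -> drsubmx M ≺ 0 ->
  P ≻ 0 -> Pnext ≻ 0 ->
  (Emx S k K)^T *m Nmx p M P Pnext *m Emx S k K ⪯ 0 <->
  block_mx (Qmx S k (invmx M) (invmx Pnext))      (Ymx S k (invmx P) (K *m invmx P))
           (Ymx S k (invmx P) (K *m invmx P))^T   (invmx P) ⪰ 0.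
Proof.
rewrite /loewner_lt /loewner_le !subr0 !sub0r.
move=> sM uM /pdmx_psdmx pul /pdmx_psdmx pdr pdP pdPn.
have pP := pdmx_psdmx pdP; have uP := pdmx_unit pdP.
have pPn := pdmx_psdmx pdPn; have uPn := pdmx_unit pdPn.
rewrite EmxE /Nmx YmxE (psdmx_schur _ _ (psdmx_invmx uP pP)) QmxE.
rewrite (@dual_graph _ _ _ _ _ _ (middle p (invmx M) (invmx Pnext))) //.
(* What remains is to relate the Schur complement C H C^T to H, by congruence with C^T one way and
   with C the other. *)
- set H := _ - _.
  set L := Lmx k K; set C := stack_assoc R n (p + r).
  have -> : C *m (row_mx (Jmx k) (- 1%:M) *m middle p (invmx M) (invmx Pnext) *m
      (row_mx (Jmx k) (- 1%:M))^T) *m C^T - C *m L *m invmx P *m (C *m L)^T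
      = C *m H *m C^T.
    by rewrite /H mulmxBr mulmxBl trmx_mul !mulmxA.
  split=> [/(psdmx_congr C^T)|/(psdmx_congr C)]; first by rewrite trmxK.
  rewrite !mulmxA tr_mul_stack_assoc mul1mx -mulmxA.
  by rewrite tr_mul_stack_assoc mulmx1.
- by apply: tr_middle => //; case: pPn.
- by apply: mulmx_middle; rewrite mulmxV.
(* The form on the complement of the graph is diag(Pnext, I, M^11). *)
- rewrite block_mxKdr; apply: psdmx_block_diag => //.
  by apply: psdmx_block_diag => //; apply: psdmx1.
- by rewrite block_mxKul; apply: invmx_dr_npsd.
Qed.

End Dualization.

(** * Equivalence of the primal and the linear matrix inequalities *)

Theorem theorem4 (R : realType) (N n m l p r s : nat) (q : 'I_s -> nat)
    (n_gt0 : (0 < n)%N) (m_gt0 : (0 < m)%N) (l_gt0 : (0 < l)%N)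
    (r_gt0 : (0 < r)%N) (s_gt0 : (0 < s)%N)
    (S : uncertain_system R n m l p r q) (S_const : constant_from S N)
    (xbar : 'cV[R]_n)
    (sqrtSigma0 : 'M[R]_(1 + n)) (sqrtSigma0P : is_psd_sqrt (Sigma0 xbar) sqrtSigma0)
    (C C' : set 'M[R]_(r + l)) (CP : multiplier_cone C C')
    (M : nat -> 'M[R]_(r + l)) (MP : forall k, (k <= N)%N -> C (M k))
    (P : nat -> 'M[R]_(1 + n)) (P_pd : forall k, (k <= N)%N -> P k ≻ 0)
    (PN1 : P N.+1 = P N)
    (K : nat -> 'M[R]_(m, 1 + n))
    (nu : R) (nu_gt0 : 0 < nu) :
  let Pt := fun k => invmx (P k) in
  let Kt := fun k => K k *m invmx (P k) in
  let nut := nu^-1 in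
  let Z := nu ^- 2 *: (sqrtSigma0 *m P 0%N *m sqrtSigma0) in
  let Mt := fun k => invmx (M k) in
  let Q := fun k => Qmx S k (Mt k) (Pt k.+1) in
  let Y := fun k => Ymx S k (Pt k) (Kt k) in
  let E := fun k => Emx S k (K k) in
  let NN := fun k => Nmx p (M k) (P k) (P k.+1) in
  let R1 := forall k, (k < N)%N -> (E k)^T *m NN k *m E k ⪯ 0 in
  let P2 := nu >= \tr (P 0%N *m Sigma0 xbar) in
  let R3 := (E N)^T *m NN N *m E N ⪯ 0 in
  let P4 := forall k (i : 'I_s), (k <= N)%N ->
    P k ⪰ nu *: ((gC2 S k i 1%:M (K k))^T *m gC2 S k i 1%:M (K k)) in
  let LR1 := forall k, (k < N)%N ->
    block_mx (Q k)     (Y k)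
             (Y k)^T   (Pt k) ⪰ 0 in
  let L2 :=
    block_mx (Pt 0%N)                (nut *: sqrtSigma0)
             (nut *: sqrtSigma0^T)   Z                   ⪰ 0
    /\ \tr Z <= nut in
  let L4 := forall k (i : 'I_s), (k <= N)%N ->
    block_mx (Pt k)                      (gC2 S k i (Pt k) (Kt k))^T
             (gC2 S k i (Pt k) (Kt k))   (nut%:M)                    ⪰ 0 in
  let LR3 :=
    block_mx (Q N)     (Y N)
             (Y N)^T   (Pt N) ⪰ 0 in
  [/\ R1, P2, R3 & P4] <-> [/\ LR1, L2, L4 & LR3].
Proof.
move=> Pt Kt nut Z Mt Q Y E NN R1 P2 R3 P4 LR1 L2 L4 LR3.
(* At k = N the convention P_{N+1} = P_N provides the second half. *)
have PP k : (k <= N)%N -> P k ≻ 0 /\ P k.+1 ≻ 0.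
  move=> kN; split; first exact: P_pd.
  by move: kN; rewrite leq_eqVlt => /predU1P[->|/P_pd//]; rewrite PN1; apply: P_pd.
have dual k : (k <= N)%N ->
    (E k)^T *m NN k *m E k ⪯ 0 <-> block_mx (Q k) (Y k) (Y k)^T (Pt k) ⪰ 0.
  move=> kN; have [_ _ /(_ _ (MP k kN))[sM uM pul pdr _]] := CP.
  by have [pP pP1] := PP k kN; apply: riccati_dualization.
have R1E : R1 <-> LR1.
  by split=> H k kN; apply/(dual k (ltnW kN))/H.
have R3E : R3 <-> LR3.
  exact: (dual N (leqnn N)).
have nu0 : nu != 0 by rewrite gt_eqF.
have L2E : P2 <-> L2.
  have [[sS pS] SS] := sqrtSigma0P.
  (* The block inequality of (L2) always holds: Z = X P_0^-1 X^T for X = nu^-1 sqrt(Sigma_0) P_0. *)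
  have psd_block : block_mx (Pt 0%N) (nut *: sqrtSigma0) (nut *: sqrtSigma0^T) Z ⪰ 0.
    have := P_pd 0%N (leq0n N); rewrite /loewner_lt /loewner_le !subr0 => pdP.
    have uP := pdmx_unit pdP.
    have XP : nut *: (sqrtSigma0 *m P 0%N) *m Pt 0%N = nut *: sqrtSigma0.
      by rewrite -scalemxAl -mulmxA mulmxV // mulmx1.
    have := @psdmx_schur_ul _ _ _ (Pt 0%N) Z (nut *: (sqrtSigma0 *m P 0%N)).
    rewrite XP [(nut *: sqrtSigma0)^T]linearZ /= sS; apply.
      exact/psdmx_invmx/pdmx_psdmx.
    suff -> : Z - nut *: sqrtSigma0 *m (nut *: (sqrtSigma0 *m P 0%N))^T = 0.
      by split=> [|x]; rewrite ?trmx0 // mulmx0 mul0mx mxE.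
    rewrite linearZ /= trmx_mul sS (proj1 pdP) -scalemxAl -scalemxAr scalerA.
    by rewrite mulmxA /Z /nut -exprVn expr2 subrr.
  (* Cyclicity of the trace; one factor [nut] stays outside to cancel against the bound in tr Z <=
     nu^-1. *)
  have trZ : \tr Z = nut * (nut * \tr (P 0%N *m Sigma0 xbar)).
    by rewrite /Z mxtraceZ mxtrace_mulC mulmxA SS mxtrace_mulC mulrA /nut -expr2 exprVn.
  rewrite /P2 /L2 trZ; split=> [le|[_ le]].
    by split=> //; rewrite ger_pMr ?invr_gt0 // /nut mulrC ler_pdivrMr // mul1r.
  by move: le; rewrite ger_pMr ?invr_gt0 // /nut mulrC ler_pdivrMr // mul1r.
have L4E : P4 <-> L4.
  rewrite /P4 /L4.
  have key k i : (k <= N)%N ->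
      P k ⪰ nu *: ((gC2 S k i 1%:M (K k))^T *m gC2 S k i 1%:M (K k)) <->
      block_mx (Pt k) (gC2 S k i (Pt k) (Kt k))^T
               (gC2 S k i (Pt k) (Kt k)) (nut%:M) ⪰ 0.
    move=> kN; have := P_pd k kN; rewrite /loewner_lt /loewner_le !subr0 => pdP.
    have uP := pdmx_unit pdP; have [sPt _] := psdmx_invmx uP (pdmx_psdmx pdP).
    have -> : gC2 S k i (Pt k) (Kt k) = gC2 S k i 1%:M (K k) *m Pt k.
      by rewrite /gC2 -mulmxA mul_col_mx mul1mx.
    set G := gC2 _ _ _ _ _.
    have pD : psdmx (nut%:M : 'M[R]_(q i)).
      by rewrite -scalemx1; apply/psdmxZ/psdmx1; rewrite invr_ge0 ltW.
    (* The factor nu compensates the pivot nu^-1 I, bringing the off-diagonal block to the form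
       [X *m D] of [psdmx_schur]. *)
    pose X := nu *: (G *m Pt k)^T.
    have XD : X *m nut%:M = (G *m Pt k)^T.
      by rewrite mul_mx_scalar scalerA mulVf // scale1r.
    have := psdmx_schur (Pt k) X pD; rewrite XD trmxK => ->.
    (* The Schur complement is the congruence by P_k^-1 of the difference in (P4); congruence by P_k
       undoes it. *)
    have -> : Pt k - (G *m Pt k)^T *m X^T =
        (Pt k)^T *m (P k - nu *: (G^T *m G)) *m Pt k.
      rewrite /X linearZ /= trmxK -scalemxAr mulmxBr mulmxBl trmx_mul sPt mulVmx //.
      by rewrite mul1mx -scalemxAr -scalemxAl !mulmxA.
    split=> [|/(psdmx_congr (P k))]; first exact: psdmx_congr.
    rewrite sPt (proj1 pdP) !mulmxA mulmxV // mul1mx.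
    by rewrite -mulmxA mulVmx // mulmx1.
  by split=> H k i kN; apply/key/H.
by split=> [[/R1E ? /L2E ? /R3E ? /L4E ?] | [/R1E ? /L2E ? /L4E ? /R3E ?]]; split.
Qed.
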